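(* For every finite generating set $X$ of the free inverse monoid $\mathrm{FIM}_1$ of rank $1$, the word problem $\mathrm{WP}(\mathrm{FIM}_1,X)$ and the two-tape word problem $\iota(\mathrm{FIM}_1,X)$ are both $2$-context-free, that is, $\mathrm{WP}(\mathrm{FIM}_1,X)$ is an intersection of two context-free languages and $\iota(\mathrm{FIM}_1,X)$ is an intersection of two context-free relations.
   Context: A monoid $M$ is inverse if for every $x\in M$ there is a unique $y\in M$ (the inverse $x^{-1}$ of $x$) with $xyx=x$ and $yxy=y$. For a set $X$, let $X^{-1}=\{\overline{x}\mid x\in X\}$ be a disjoint set of formal inverses and $X^{\pm}=X\cup X^{-1}$; put $x^{-1}=\overline{x}$ and $\overline{x}^{-1}=x$ for $x\in X$, and for a word $w=w_1\cdots w_n$ with $w_i\in X^{\pm}$ put $w^{\mathrm{inv}}=w_n^{-1}\cdots w_1^{-1}$. The free inverse monoid $\mathrm{FIM}(X)$ is the free object on $X$ in the variety of inverse monoids, i.e. the quotient of $(X^{\pm})^*$ by the relations $u=uu^{\mathrm{inv}}u$ and $uu^{\mathrm{inv}}vv^{\mathrm{inv}}=vv^{\mathrm{inv}}uu^{\mathrm{inv}}$ for $u,v\in (X^{\pm})^*$. If $|X|=k$ it is denoted $\mathrm{FIM}_k$. If $M$ is an inverse monoid and $X\subseteq M$ is a finite set generating $M$ as an inverse monoid, words over $X^{\pm}$ are evaluated in $M$ by interpreting $\overline{x}$ as the inverse of $x$, and $u=_M v$ means that $u$ and $v$ represent the same element of $M$. With $\#$ a symbol not in $X^{\pm}$, $$\mathrm{WP}(M,X)=\{u\#v^{\mathrm{inv}}\mid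 u,v\in (X^{\pm})^*,\ u=_M v\},$$ $$\iota(M,X)=\{(u,v)\in (X^{\pm})^*\times (X^{\pm})^*\mid u=_M v\}.$$ A relation $R\subseteq A^*\times A^*$ ($A$ a finite alphabet) is called context-free if it is accepted by a nondeterministic two-tape pushdown automaton (one stack, two one-way input tapes read asynchronously); equivalently, if $R$ is the image of a context-free language over the alphabet $\{(a,\varepsilon),(\varepsilon,a)\mid a\in A\}$ under the natural homomorphism to $A^*\times A^*$. *)

(* Defs.v *)
From HB Require Import structures.
From Stdlib Require Import Relation_Operators.
From mathcomp Require Import all_boot finmap boolp classical_sets.

Set Implicit Arguments.
Unset Strict Implicit.
Unset Printing Implicit Defensive.

Local Open Scope group_scope.
Local Open Scope classical_set_scope.

(** [starMonoidType] supplies an involutive anti-automorphism [x^-1]; the mixin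
    makes [x^-1] the unique [y] such that [x * y * x = x] and [y * x * y = y].
    Involutivity and anti-multiplicativity hold in every inverse monoid, so
    inheriting from [starMonoidType] adds no restriction. *)
HB.mixin Record StarMonoid_isInverseMonoid M of StarMonoid M := {
  mulgVg : forall x : M, x * x^-1 * x = x;
  mulVgV : forall x : M, x^-1 * x * x^-1 = x^-1;
  inverse_uniq : forall x y : M, x * y * x = x -> y * x * y = y -> y = x^-1
}.

#[short(type="inverseMonoidType")]
HB.structure Definition InverseMonoid :=
  { M of StarMonoid_isInverseMonoid M & StarMonoid M }.

(** [(x, false)] is the letter [x], and [(x, true)] is its formal inverse. *)
Notation signed T := (T * bool)%type.

Definition inv_letter T (a : signed T) : signed T := (a.1, ~~ a.2).

Definition inv_word T (w : seq (signed T)) : seq (signed T) :=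
  rev (map (@inv_letter T) w).

Lemma inv_wordK T : involutive (@inv_word T).
Proof.
move=> w; rewrite /inv_word map_rev revK -map_comp -[RHS]map_id.
by apply: eq_map => -[x b]; rewrite /inv_letter /= negbK.
Qed.

Lemma inv_word_cat T (u v : seq (signed T)) :
  inv_word (u ++ v) = inv_word v ++ inv_word u.
Proof. by rewrite /inv_word map_cat rev_cat. Qed.

(** The monoid congruence on words generated by [u = u u^inv u] and
    [u u^inv v v^inv = v v^inv u u^inv]. *)
Inductive fim_cong (T : Type) : seq (signed T) -> seq (signed T) -> Prop :=
| fim_cong_refl u : fim_cong u u
| fim_cong_sym u v : fim_cong u v -> fim_cong v u
| fim_cong_trans u v w : fim_cong u v -> fim_cong v w -> fim_cong u w
| fim_cong_cat u u' v v' :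
    fim_cong u u' -> fim_cong v v' -> fim_cong (u ++ v) (u' ++ v')
| fim_cong_inv u : fim_cong u (u ++ inv_word u ++ u)
| fim_cong_comm u v :
    fim_cong (u ++ inv_word u ++ v ++ inv_word v)
             (v ++ inv_word v ++ u ++ inv_word u).

Lemma fim_cong_inv_word T (u v : seq (signed T)) :
  fim_cong u v -> fim_cong (inv_word u) (inv_word v).
Proof.
elim=> {u v}.
- by move=> u; apply: fim_cong_refl.
- by move=> u v _; apply: fim_cong_sym.
- by move=> u v w _ uv _; apply: fim_cong_trans.
- by move=> u u' v v' _ uu' _ vv'; rewrite !inv_word_cat; apply: fim_cong_cat.
- move=> u; rewrite !inv_word_cat inv_wordK -catA.
  by have := fim_cong_inv (inv_word u); rewrite inv_wordK.
- move=> u v; rewrite !inv_word_cat !inv_wordK -!catA.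
  exact: fim_cong_comm.
Qed.

Section FreeInverseMonoid.
Variable T : choiceType.

Definition fim_congb (u v : seq (signed T)) : bool := `[< fim_cong u v >].

Lemma fim_congb_refl : reflexive fim_congb.
Proof. by move=> u; apply/asboolP/fim_cong_refl. Qed.

Lemma fim_congb_sym : symmetric fim_congb.
Proof. by move=> u v; apply/asboolP/asboolP => /fim_cong_sym. Qed.

Lemma fim_congb_trans : transitive fim_congb.
Proof.
by move=> v u w /asboolP uv /asboolP vw; apply/asboolP/(fim_cong_trans uv vw).
Qed.

Canonical fim_equiv :=
  EquivRel fim_congb fim_congb_refl fim_congb_sym fim_congb_trans.

Definition FIM := {eq_quot fim_equiv}%qT.
HB.instance Definition _ := Choice.on FIM.

Definition fim_class (w : seq (signed T)) : FIM := (\pi_FIM w)%qT.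

Lemma fim_classP (u v : seq (signed T)) :
  fim_class u = fim_class v <-> fim_cong u v.
Proof.
split => [/eqmodP/asboolP //|uv].
by apply/eqmodP/asboolP.
Qed.

Lemma fim_class_repr (x : FIM) : fim_class (repr x) = x.
Proof. exact: reprK. Qed.

Definition fim_one : FIM := fim_class [::].
Definition fim_mul (x y : FIM) : FIM := fim_class (repr x ++ repr y).
Definition fim_inv (x : FIM) : FIM := fim_class (inv_word (repr x)).

Lemma fim_class_cat u v :
  fim_class (u ++ v) = fim_mul (fim_class u) (fim_class v).
Proof.
by apply/fim_classP/fim_cong_cat; apply/fim_classP; rewrite fim_class_repr.
Qed.

Lemma fim_class_inv_word u : fim_class (inv_word u) = fim_inv (fim_class u).
Proof.
by apply/fim_classP/fim_cong_inv_word/fim_classP; rewrite fim_class_repr.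
Qed.

Lemma fim_ind (P : FIM -> Prop) : (forall w, P (fim_class w)) -> forall x, P x.
Proof. by move=> Pw x; rewrite -[x]fim_class_repr. Qed.

Lemma fim_mulA : associative fim_mul.
Proof.
elim/fim_ind=> u; elim/fim_ind=> v; elim/fim_ind=> w.
by rewrite -!fim_class_cat catA.
Qed.

Lemma fim_mul1g : left_id fim_one fim_mul.
Proof. by elim/fim_ind=> u; rewrite -fim_class_cat. Qed.

Lemma fim_invK : involutive fim_inv.
Proof. by elim/fim_ind=> u; rewrite -!fim_class_inv_word inv_wordK. Qed.

Lemma fim_invM : {morph fim_inv : x y / fim_mul x y >-> fim_mul y x}.
Proof.
elim/fim_ind=> u; elim/fim_ind=> v.
by rewrite -!(fim_class_inv_word, fim_class_cat) inv_word_cat.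
Qed.

HB.instance Definition _ := isStarMonoid.Build FIM
  fim_mulA fim_mul1g fim_invK fim_invM.

Lemma fim_mulgVg (x : FIM) : x * x^-1 * x = x.
Proof.
elim/fim_ind: x => u; rewrite -mulgA.
transitivity (fim_class (u ++ inv_word u ++ u)).
  by rewrite !fim_class_cat fim_class_inv_word.
exact/esym/fim_classP/fim_cong_inv.
Qed.

Lemma fim_mulVgV (x : FIM) : x^-1 * x * x^-1 = x^-1.
Proof. by have := fim_mulgVg x^-1; rewrite invgK. Qed.

Lemma fim_mulgV_comm (x y : FIM) :
  x * x^-1 * (y * y^-1) = y * y^-1 * (x * x^-1).
Proof.
elim/fim_ind: x => u; elim/fim_ind: y => v; rewrite -!mulgA.
transitivity (fim_class (u ++ inv_word u ++ v ++ inv_word v)).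
  by rewrite !fim_class_cat !fim_class_inv_word.
have /fim_classP -> := fim_cong_comm u v.
by rewrite !fim_class_cat !fim_class_inv_word.
Qed.

Lemma fim_idem_inv (e : FIM) : e * e = e -> e = e^-1.
Proof.
move=> ee; have e'e' : e^-1 * e^-1 = e^-1 by rewrite -invgM ee.
have := fim_mulgV_comm e e^-1; rewrite invgK => c.
have E : e^-1 * e * (e * e^-1) = e^-1.
  by rewrite mulgA -(mulgA _ e e) ee fim_mulVgV.
by rewrite -[RHS]E -c mulgA -(mulgA e) e'e' fim_mulgVg.
Qed.

Lemma fim_idem_comm (e f : FIM) : e * e = e -> f * f = f -> e * f = f * e.
Proof.
move=> ee ff; have := fim_mulgV_comm e f.
by rewrite -(fim_idem_inv ee) -(fim_idem_inv ff) ee ff.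
Qed.

Lemma fim_inverse_uniq (x y : FIM) :
  x * y * x = x -> y * x * y = y -> y = x^-1.
Proof.
move=> xyx yxy; have xVx := fim_mulgVg x; have VxV := fim_mulVgV x.
have xy2 : x * y * (x * y) = x * y by rewrite mulgA xyx.
have yx2 : y * x * (y * x) = y * x by rewrite mulgA yxy.
have xV2 : x * x^-1 * (x * x^-1) = x * x^-1 by rewrite mulgA xVx.
have Vx2 : x^-1 * x * (x^-1 * x) = x^-1 * x by rewrite mulgA VxV.
have c1 := fim_idem_comm xy2 xV2; have c2 := fim_idem_comm yx2 Vx2.
transitivity (y * (x * x^-1)).
  have -> : x * x^-1 = x * y * (x * x^-1) by rewrite mulgA xyx.
  by rewrite c1 [_ * (x * y)]mulgA xVx mulgA yxy.
have -> : y * (x * x^-1) = y * x * (x^-1 * x) * x^-1.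
  by rewrite -!mulgA [x^-1 * (x * _)]mulgA VxV.
by rewrite c2 !mulgA -(mulgA _ x y) -(mulgA _ (x * y)) xyx VxV.
Qed.

HB.instance Definition _ := StarMonoid_isInverseMonoid.Build FIM
  fim_mulgVg fim_mulVgV fim_inverse_uniq.

End FreeInverseMonoid.

Section WordProblems.
Variable M : inverseMonoidType.

Definition inverse_submonoid (S : set M) : Prop :=
  [/\ S 1, forall x y, S x -> S y -> S (x * y) & forall x, S x -> S x^-1].

Definition inverse_generates (X : {fset M}) : Prop :=
  forall S : set M, inverse_submonoid S -> [set` X] `<=` S -> S = setT.

Variable X : {fset M}.

Definition eval_letter (a : signed X) : M :=
  if a.2 then (val a.1)^-1 else val a.1.

Definition eval_word (w : seq (signed X)) : M := \prod_(a <- w) eval_letter a.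

(** The symbol # is [None]. *)
Definition WP : set (seq (option (signed X))) :=
  [set w | exists u v, eval_word u = eval_word v
                       /\ w = map Some u ++ None :: map Some (inv_word v)].

Definition two_tape_WP : set (seq (signed X) * seq (signed X)) :=
  [set uv | eval_word uv.1 = eval_word uv.2].

End WordProblems.

Arguments inverse_submonoid {M} S.
Arguments inverse_generates {M} X.
Arguments eval_letter {M X} a.
Arguments eval_word {M X} w.
Arguments WP {M} X.
Arguments two_tape_WP {M} X.

Record cfg (A : finType) := Cfg {
  cfg_nonterm : finType;
  cfg_start : cfg_nonterm;
  cfg_rules : seq (cfg_nonterm * seq (cfg_nonterm + A))
}.

Inductive cfg_step (A : finType) (G : cfg A) :
    seq (cfg_nonterm G + A) -> seq (cfg_nonterm G + A) -> Prop :=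
| CfgStep N r s t : (N, r) \in cfg_rules G ->
    cfg_step (s ++ inl N :: t) (s ++ r ++ t).

Definition cfg_lang (A : finType) (G : cfg A) : set (seq A) :=
  [set w | clos_refl_trans _ (@cfg_step A G)
             [:: inl (cfg_start G)] (map inr w)].

Definition context_free (A : finType) (L : set (seq A)) : Prop :=
  exists G : cfg A, L = cfg_lang G.

Definition k_context_free (k : nat) (A : finType) (L : set (seq A)) : Prop :=
  exists K : 'I_k -> set (seq A),
    (forall i, context_free (K i)) /\ L = \bigcap_i K i.

(** A transition [(p, a, b, z, q, g)] goes from state [p] to state [q], reads
    [a] on the first tape and [b] on the second one ([None] reads nothing), and
    replaces the top stack symbol [z] by the string [g]; the top of the stack is
    the head of the sequence.  Acceptance is by final state, with both tapes
    entirely read. *)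
Record pda2 (A : finType) := Pda2 {
  pda2_state : finType;
  pda2_stack : finType;
  pda2_init : pda2_state;
  pda2_bottom : pda2_stack;
  pda2_final : {set pda2_state};
  pda2_trans : seq (pda2_state * option A * option A * pda2_stack
                    * pda2_state * seq pda2_stack)
}.

Definition pda2_config (A : finType) (P : pda2 A) : Type :=
  (pda2_state P * seq A * seq A * seq (pda2_stack P))%type.

Inductive pda2_step (A : finType) (P : pda2 A) :
    pda2_config P -> pda2_config P -> Prop :=
| Pda2Step p a b z q g u v s : (p, a, b, z, q, g) \in pda2_trans P ->
    pda2_step (p, seq_of_opt a ++ u, seq_of_opt b ++ v, z :: s)
              (q, u, v, g ++ s).

Definition pda2_rel (A : finType) (P : pda2 A) : set (seq A * seq A) :=
  [set uv | exists2 q, q \in pda2_final P & exists s,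
     clos_refl_trans _ (@pda2_step A P)
       (pda2_init P, uv.1, uv.2, [:: pda2_bottom P]) (q, [::], [::], s)].

Definition context_free_rel (A : finType) (R : set (seq A * seq A)) : Prop :=
  exists P : pda2 A, R = pda2_rel P.

Definition k_context_free_rel (k : nat) (A : finType)
    (R : set (seq A * seq A)) : Prop :=
  exists K : 'I_k -> set (seq A * seq A),
    (forall i, context_free_rel (K i)) /\ R = \bigcap_i K i.

(* Main.v *)
From Stdlib Require Import Relation_Operators Operators_Properties.
Require Import Defs.
From mathcomp Require Import all_boot finmap boolp classical_sets.
From mathcomp Require Import order ssralg ssrnum ssrint zify.

Set Implicit Arguments.
Unset Strict Implicit.
Unset Printing Implicit Defensive.

Import Order.TTheory GRing.Theory Num.Theory.

Local Open Scope classical_set_scope.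

(** A word over the generators is a path on the integer line, and two words are
    equal in the free inverse monoid of rank 1 if and only if their paths have
    the same maximum, the same minimum and the same endpoint.  Having the same
    maximum and the same endpoint is a context-free condition: both paths climb
    to the maximum and then descend to the endpoint, one level at a time and in
    step with each other, with excursions below the current level in between,
    and only the excursions need a stack.  In [u # v^inv] the second path is
    read backwards from the endpoint, so the levels are nested rather than in
    step.  Exchanging up and down deals with the minimum.  A generator stands
    for a whole path, and this is absorbed by a finite transducer that buffers
    the steps of the last letter read. *)

(** * Paths *)

(* A path is a sequence of steps, [true] going up.  The truncated predecessor
   makes [height] the maximum over all prefixes, the empty one included. *)
Fixpoint height (w : seq bool) : nat :=
  if w is b :: w' then if b then (height w').+1 else (height w').-1 else 0.

Fixpoint endpoint (w : seq bool) : int :=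
  if w is b :: w' then (endpoint w' + (if b then 1 : int else -1))%R else 0%R.

Definition reverse_path (w : seq bool) : seq bool := rev (map negb w).

Lemma endpoint_cat u v : endpoint (u ++ v) = (endpoint u + endpoint v)%R.
Proof. by elim: u => [|b u IHu] /=; lia. Qed.

(** The highest level is reached either inside [u] or inside [v], whose levels are shifted by the
    endpoint of [u]. The shift may be negative, hence the integers. *)
Lemma height_cat u v :
  ((height (u ++ v))%:Z = Num.max (height u)%:Z (endpoint u + (height v)%:Z))%R.
Proof. by elim: u => [|[] u IHu] /=; lia. Qed.

Lemma reverse_path_cat u v :
  reverse_path (u ++ v) = reverse_path v ++ reverse_path u.
Proof. by rewrite /reverse_path map_cat rev_cat. Qed.

Lemma reverse_path_cons b w :
  reverse_path (b :: w) = reverse_path w ++ [:: ~~ b].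
Proof. by rewrite -cat1s reverse_path_cat. Qed.

Lemma reverse_pathK : involutive reverse_path.
Proof. by move=> w; rewrite /reverse_path map_rev revK mapK //; apply: negbK. Qed.

Lemma reverse_path_negb w :
  reverse_path (map negb w) = map negb (reverse_path w).
Proof. by rewrite /reverse_path map_rev. Qed.

Lemma endpoint_reverse w : endpoint (reverse_path w) = (- endpoint w)%R.
Proof.
by elim: w => [|[] w IHw] //; rewrite reverse_path_cons endpoint_cat IHw /=; lia.
Qed.

Lemma endpoint_negb w : endpoint (map negb w) = (- endpoint w)%R.
Proof. by elim: w => [|[] w IHw] //=; lia. Qed.

(** The reversed path visits the same levels, now measured from the endpoint of [w]. *)
Lemma height_reverse w :
  ((height (reverse_path w))%:Z = (height w)%:Z - endpoint w)%R.
Proof.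
elim: w => [|b w IHw] //.
by rewrite reverse_path_cons height_cat IHw endpoint_reverse; case: b => /=; lia.
Qed.

(** * Decomposition of paths level by level *)

(* The excursions are below the origin. *)
Inductive dyck : seq bool -> Prop :=
| dyck_nil : dyck [::]
| dyck_cons d d' : dyck d -> dyck d' -> dyck (false :: d ++ true :: d').

Lemma dyckP w : dyck w -> height w = 0%N /\ endpoint w = 0%R.
Proof.
elim=> // d d' _ [hd ed] _ [hd' ed'].
have := height_cat d (true :: d').
by rewrite /= endpoint_cat /= hd ed hd' ed'; lia.
Qed.

(* First passage above the origin if there is one, otherwise last passage at
   the origin. *)
Variant passage_spec (w : seq bool) : Prop :=
| PassageClosed of dyck w
| PassageUp d w' of dyck d & w = d ++ true :: w'
| PassageDown d w' of dyck d & w = d ++ false :: w' & height w' = 0%N.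

(** Induction on the length: after a first step down, the tail either passes above its own start,
    which closes an excursion and leaves a shorter path, or never does, and then the first step is
    the last departure from the origin. *)
Lemma passageP w : passage_spec w.
Proof.
have [n] := ubnP (size w); elim: n w => // n IHn [|[] w] /= ltwn.
- exact/PassageClosed/dyck_nil.
- exact: (PassageUp dyck_nil).
have [dw|d w' dd def_w|d w' dd def_w hw'] := IHn _ ltwn.
- apply: (PassageDown (d := [::]) (w' := w)) => //; first exact: dyck_nil.
  by have [] := dyckP dw.
- subst w; have ltw'n : (size w' < n)%N by move: ltwn; rewrite size_cat /=; lia.
  have [dw'|d' w'' dd' ->|d' w'' dd' -> hw''] := IHn _ ltw'n.
  + exact/PassageClosed/dyck_cons.
  + apply: (PassageUp (d := false :: d ++ true :: d')) => //.
    * exact: dyck_cons.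
    * by rewrite /= -catA.
  + apply: (PassageDown (d := false :: d ++ true :: d') _ _ hw'') => //.
    * exact: dyck_cons.
    * by rewrite /= -catA.
- apply: (PassageDown (d := [::]) (w' := w)) => //; first exact: dyck_nil.
  have [hd ed] := dyckP dd; have := height_cat d (false :: w').
  by rewrite -def_w /= hd ed hw' /=; lia.
Qed.

(** The other cases of [passageP] are excluded: a passage up makes the height positive, and a last
    passage down makes the endpoint negative. *)
Lemma dyck_eq w : height w = 0%N -> endpoint w = 0%R -> dyck w.
Proof.
case: (passageP w) => // d w' dd -> => [|hw']; have [hd ed] := dyckP dd;
  have := height_cat d (true :: w'); rewrite !endpoint_cat hd ed /=; try lia.
move=> _ _ e; have := height_reverse w'; lia.
Qed.

Lemma dyck_reverse w : dyck w -> dyck (reverse_path w).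
Proof.
move/dyckP=> [hw ew]; apply: dyck_eq; last by rewrite endpoint_reverse ew.
by have := height_reverse w; rewrite hw ew; lia.
Qed.

(* [same_top] pairs the climbs of two paths level by level, [same_descent] pairs
   their descents. *)
Inductive same_descent : seq bool -> seq bool -> Prop :=
| SameDescentNil d d' : dyck d -> dyck d' -> same_descent d d'
| SameDescentCons d d' u v : dyck d -> dyck d' -> same_descent u v ->
    same_descent (d ++ false :: u) (d' ++ false :: v).

Inductive same_top : seq bool -> seq bool -> Prop :=
| SameTopDescent u v : same_descent u v -> same_top u v
| SameTopCons d d' u v : dyck d -> dyck d' -> same_top u v ->
    same_top (d ++ true :: u) (d' ++ true :: v).

Lemma height_dyck_cons d b w : dyck d ->
  height (d ++ b :: w) = if b then (height w).+1 else (height w).-1.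
Proof.
by move=> /dyckP [hd ed]; have := height_cat d (b :: w); case: b => /=; lia.
Qed.

Lemma endpoint_dyck_cons d b w : dyck d ->
  endpoint (d ++ b :: w) = endpoint (b :: w).
Proof. by move=> /dyckP [hd ed]; rewrite endpoint_cat ed add0r. Qed.

(** The difference is the height of the reversed path, a natural number. *)
Lemma endpoint_le_height w : (endpoint w <= (height w)%:Z)%R.
Proof. by have := height_reverse w; lia. Qed.

(** A path of height zero makes as many last passages down as its endpoint is below the origin, so
    equal endpoints let the two decompositions be paired to the end. *)
Lemma same_descentP u v : same_descent u v <->
  [/\ height u = 0%N, height v = 0%N & endpoint u = endpoint v].
Proof.
split.
  elim=> {u v} [d d' /dyckP [hd ed] /dyckP [hd' ed']|d d' u v dd dd' _ [hu hv e]].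
    by rewrite ed ed'.
  by rewrite !height_dyck_cons // !endpoint_dyck_cons //= hu hv e.
have [n] := ubnP (size u); elim: n u v => // n IHn u v.
case: (passageP u) => [du|d u' dd ->|d u' dd -> hu'] ltun;
  try by rewrite height_dyck_cons //; case.
- case: (passageP v) => [dv _|d' v' dd' ->|d' v' dd' -> hv'].
  + exact: SameDescentNil.
  + by rewrite height_dyck_cons //; case.
  + have [_ ->] := dyckP du; rewrite endpoint_dyck_cons //= => -[_ _].
    by have := endpoint_le_height v'; lia.
- case: (passageP v) => [dv|d' v' dd' ->|d' v' dd' -> hv'].
  + have [_ ->] := dyckP dv; rewrite endpoint_dyck_cons //= => -[_ _].
    by have := endpoint_le_height u'; lia.
  + by rewrite [height (d' ++ _)]height_dyck_cons //; case.
  + rewrite !endpoint_dyck_cons //= => -[_ _ e].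
    apply: SameDescentCons => //; apply: IHn; last by split=> //; lia.
    by move: ltun; rewrite size_cat /=; lia.
Qed.

(** Induction on the common height: each first passage up is peeled off both paths, and at height
    zero only the descents remain. *)
Lemma same_topP u v :
  same_top u v <-> height u = height v /\ endpoint u = endpoint v.
Proof.
split.
  elim=> {u v} [u v /same_descentP [-> ->] //|d d' u v dd dd' _ [h e]].
  by rewrite !height_dyck_cons // !endpoint_dyck_cons //= h e.
move hn: (height u) => n [hv e]; elim: n u v hn hv e => [|n IHn] u v.
  by move=> hu hv e; apply/SameTopDescent/same_descentP.
case: (passageP u) => [/dyckP [-> //]|d u' dd ->|d u' dd -> hu'];
  last by rewrite height_dyck_cons ?hu'.
case: (passageP v) => [/dyckP [-> //]|d' v' dd' ->|d' v' dd' -> hv'];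
  last by rewrite [height (d' ++ _)]height_dyck_cons ?hv'.
rewrite !height_dyck_cons // => -[hu] [hv].
rewrite !endpoint_dyck_cons //= => e.
by apply: SameTopCons => //; apply: IHn => //; lia.
Qed.

(** * The word problem of the free monogenic inverse monoid *)

Lemma fim_classM (T : choiceType) (u v : seq (signed T)) :
  fim_class (u ++ v) = (fim_class u * fim_class v)%g.
Proof. exact: fim_class_cat. Qed.

Section NormalForm.
Variable T : choiceType.
Local Open Scope group_scope.
Implicit Type x : FIM T.

(** Exponents do not add up across signs in an inverse monoid, so the extremes of a path must be
    recorded separately, by idempotents. *)
Definition zexp x (p : int) : FIM T :=
  if p is Negz n then x^-1 ^+ n.+1 else x ^+ absz p.

(** The idempotent of the path that climbs [n] steps and comes back; with [x^-1] for [x] it goes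
    down instead. *)
Definition up_idem x n := x ^+ n * x^-1 ^+ n.

(* The class of the paths of maximum [r], minimum [- l] and endpoint [p]. *)
Definition normal_form x (r l : nat) (p : int) :=
  up_idem x r * up_idem x^-1 l * zexp x p.

Lemma expVg x n : x^-1 ^+ n = (x ^+ n)^-1.
Proof.
elim: n => [|n IHn]; first by rewrite !expg0 invg1.
by rewrite expgS expgSr IHn invgM.
Qed.

Lemma up_idemC x y m n : up_idem x m * up_idem y n = up_idem y n * up_idem x m.
Proof. by rewrite /up_idem !expVg fim_mulgV_comm. Qed.

(** On the right, a factor [x] splits off in front of two idempotents; once these are commuted,
    [x x^-1 x = x] removes the second one. *)
Lemma mulg_up_idem x n : x * up_idem x n = up_idem x n.+1 * x.
Proof.
have -> : up_idem x n.+1 * x = x * (up_idem x n * up_idem x^-1 1).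
  by rewrite /up_idem invgK !expg1 expgS expgSr !mulgA.
by rewrite up_idemC {2}/up_idem invgK !expg1 !mulgA mulgVg.
Qed.

Lemma up_idem_absorb x m n : (m <= n)%N -> up_idem x m * up_idem x n = up_idem x n.
Proof.
move=> /subnKC <-; move: (n - m)%N => k; rewrite {2 3}/up_idem expgnDr !mulgA.
by rewrite /up_idem !expVg fim_mulgVg.
Qed.

Lemma mulg_up_idemV x n : x * up_idem x^-1 n.+1 = up_idem x 1 * up_idem x^-1 n * x.
Proof.
by rewrite /up_idem !invgK !expg1 (expgS x^-1) (expgSr x) !mulgA.
Qed.

(** For negative [p] the detour [x x^-1] is really there; for nonnegative [p] the next power of [x]
    absorbs it. *)
Lemma mulg_zexp x p : x * zexp x p = up_idem x 1 * zexp x (p + 1)%R.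
Proof.
rewrite /up_idem !expg1; case: p => [n|[|n]].
- by rewrite /= addn1 expgS !mulgA mulgVg.
- by rewrite /= expg1 expg0 mulg1.
- have -> : (Negz n.+1 + 1)%R = Negz n by lia.
  by rewrite /= expgS !mulgA.
Qed.

(** A step up put in front lifts the whole path by one level, but the minimum still counts the
    origin, hence the truncated [l.-1]. The bound says that the endpoint is not below the
    minimum. *)
Lemma mulg_normal_form x r l p : (- l%:Z <= p)%R ->
  x * normal_form x r l p = normal_form x r.+1 l.-1 (p + 1)%R.
Proof.
rewrite /normal_form 2!mulgA mulg_up_idem; case: l => [|l] pl.
  case: p pl => // n _.
  by rewrite /= {2 4}/up_idem !expg0 !mulg1 addn1 expgS mulgA.
rewrite -(mulgA _ x) mulg_up_idemV [l.+1.-1]/=.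
(* Crossing [up_idem x^-1 l.+1] and [zexp x p] each leaves a factor [up_idem x 1]; both commute to
   [up_idem x r.+1] and are absorbed there. *)
have := mulg_zexp x p; have := up_idemC x x^-1 1 l.
have := @up_idem_absorb x 1 r.+1 isT; rewrite up_idemC.
move: (up_idem x 1) (up_idem x^-1 l) (up_idem x r.+1) => e f g ge ef xp.
by rewrite -!mulgA xp !mulgA ge -(mulgA g f e) -ef mulgA ge.
Qed.

Lemma normal_formV x r l p :
  normal_form x^-1 r l p = normal_form x l r (- p)%R.
Proof.
rewrite /normal_form invgK up_idemC; congr (_ * _).
by case: p => [[|n]|n] //=; rewrite invgK.
Qed.

End NormalForm.

(** The boolean of a letter marks a formal inverse, which is a step down; hence the negation. *)
Definition steps (w : seq (signed 'I_1)) : seq bool :=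
  [seq ~~ a.2 | a <- w].

Lemma steps_cat u v : steps (u ++ v) = steps u ++ steps v.
Proof. exact: map_cat. Qed.

Lemma steps_inv_word w : steps (inv_word w) = reverse_path (steps w).
Proof. by rewrite /steps /inv_word /reverse_path !map_rev -!map_comp. Qed.

Lemma fim_class_normal_form w :
  let s := steps w in
  fim_class w = normal_form (fim_class [:: (ord0, false)])
                  (height s) (height (map negb s)) (endpoint s).
Proof.
set x := fim_class [:: _]; elim: w => [|[i b] w IHw] /=.
  by rewrite /normal_form /up_idem !expg0 !mulg1.
rewrite -cat1s fim_classM IHw (ord1 i).
(* These bounds place the endpoint between the minimum and the maximum, as [mulg_normal_form]
   requires. *)
have le_e := endpoint_le_height (map negb (steps w)).
rewrite endpoint_negb in le_e; have le_e' := endpoint_le_height (steps w).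
case: b => /=; last by rewrite -mulg_normal_form //; lia.
have -> : fim_class [:: (ord0, true)] = (x^-1)%g.
  exact: (fim_class_inv_word [:: (ord0, false)]).
(* A step down is a step up for [x^-1], whose normal form exchanges maximum and minimum. *)
have nfV r l p : normal_form x r l p = normal_form x^-1%g l r (- p)%R.
  by rewrite normal_formV opprK.
by rewrite !nfV mulg_normal_form ?opprD ?opprK //; lia.
Qed.

(** Equal invariants give equal normal forms; conversely, each generating relation of the congruence
    preserves the three invariants. *)
Lemma fim_congP u v : let s := steps u in let t := steps v in
  fim_cong u v <->
  [/\ height s = height t, height (map negb s) = height (map negb t)
    & endpoint s = endpoint t].
Proof.
split=> [|[h h' e]]; last first.
  apply/fim_classP.
  have := fim_class_normal_form u; have := fim_class_normal_form v.
  by rewrite /= h h' e => ->.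
elim=> {u v} //=; last 3 first.
- move=> u u' v v' _ [hu nu eu] _ [hv nv ev].
  have := height_cat (steps u) (steps v).
  have := height_cat (steps u') (steps v').
  have := height_cat (map negb (steps u)) (map negb (steps v)).
  have := height_cat (map negb (steps u')) (map negb (steps v')).
  rewrite !steps_cat !map_cat !endpoint_cat !endpoint_negb.
  by rewrite hu nu eu hv nv ev => h1 h2 h3 h4; split; lia.
- move=> u.
  (* Retracing a path visits no new level. *)
  have E s : height (s ++ reverse_path s ++ s) = height s.
    have := endpoint_le_height s.
    have := height_cat s (reverse_path s ++ s).
    have := height_cat (reverse_path s) s.
    by rewrite height_reverse endpoint_reverse; lia.
  rewrite !steps_cat steps_inv_word !map_cat -!reverse_path_negb !E.
  by rewrite !endpoint_cat endpoint_reverse; split=> //; lia.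
- move=> u v.
  (* Both loops are based at the origin, so the maximum is symmetric in [s] and [t]. *)
  have E s t : ((height (s ++ reverse_path s ++ t ++ reverse_path t))%:Z
      = Num.max (height s)%:Z (height t)%:Z)%R.
    have := endpoint_le_height s; have := endpoint_le_height t.
    have := height_cat s (reverse_path s ++ t ++ reverse_path t).
    have := height_cat (reverse_path s) (t ++ reverse_path t).
    have := height_cat t (reverse_path t).
    by rewrite !height_reverse !endpoint_reverse; lia.
  rewrite !steps_cat !steps_inv_word !map_cat -!reverse_path_negb.
  have := E (steps u) (steps v); have := E (steps v) (steps u).
  have := E (map negb (steps u)) (map negb (steps v)).
  have := E (map negb (steps v)) (map negb (steps u)).
  by rewrite !endpoint_cat !endpoint_reverse => h1 h2 h3 h4; split; lia.
- by move=> u v _ [-> -> ->].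
- by move=> u v w _ [-> -> ->] _ [-> -> ->].
Qed.

(** * Context-free grammars and transducers *)

Section Derivations.
Variables (A : finType) (G : cfg A).
Local Notation sym := (cfg_nonterm G + A)%type.

(** Parse forests, read from the left: unlike sequences of rewriting steps, they allow structural
    induction and split along concatenations. *)
Inductive derives : seq sym -> seq A -> Prop :=
| derives_nil : derives [::] [::]
| derives_term a s w : derives s w -> derives (inr a :: s) (a :: w)
| derives_nonterm N r s w1 w2 : (N, r) \in cfg_rules G ->
    derives r w1 -> derives s w2 -> derives (inl N :: s) (w1 ++ w2).

Lemma derives_cat s t u v :
  derives s u -> derives t v -> derives (s ++ t) (u ++ v).
Proof.
elim=> {s u} //= [a s u _ IHs tv|N r s w1 w2 Nr r1 _ _ IHs tv].
  by apply: derives_term; apply: IHs.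
by rewrite -catA; apply: derives_nonterm Nr r1 _; apply: IHs.
Qed.

Lemma derives_consE c s w : derives (c :: s) w ->
  exists u v, [/\ w = u ++ v, derives [:: c] u & derives s v].
Proof.
move=> d; inversion d as [|a s' w' d'|N r s' w1 w2 Nr d1 d2]; subst.
  by exists [:: a], w'; split=> //; apply/derives_term/derives_nil.
exists w1, w2; split=> //; rewrite -[w1]cats0.
exact: derives_nonterm Nr d1 derives_nil.
Qed.

Lemma derives_catE s t w : derives (s ++ t) w ->
  exists u v, [/\ w = u ++ v, derives s u & derives t v].
Proof.
elim: s w => [|c s IHs] w /=.
  by exists [::], w; split=> //; apply: derives_nil.
move=> /derives_consE [u [v [-> cu /IHs [u' [v' [-> su tv]]]]]].
by exists (u ++ u'), v'; split; rewrite ?catA // -cat1s; apply: derives_cat.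
Qed.

Lemma derivesP s w :
  clos_refl_trans _ (@cfg_step A G) s (map inr w) <-> derives s w.
Proof.
split.
  move=> /clos_rt_rt1n_iff; move def_t: (map inr w) => t st.
  elim: st def_t => {s t} [s <-|s s' t [N r p q Nr] _ IH /IH].
    by elim: w => [|a w IHw]; [apply: derives_nil | apply: derives_term].
  move=> /derives_catE [u [_ [-> pu /derives_catE [v [v' [-> rv qv']]]]]].
  by apply: derives_cat pu _; apply: derives_nonterm Nr rv qv'.
(* Rewriting is closed under contexts, so independent parts can be rewritten one after the other. *)
have ctx p q s1 s2 : clos_refl_trans _ (@cfg_step A G) s1 s2 ->
    clos_refl_trans _ (@cfg_step A G) (p ++ s1 ++ q) (p ++ s2 ++ q).
  elim=> {s1 s2} [s1 s2 [N r s1' s2' Nr]|s1|s1 s2 s3 _ IH1 _ IH2].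
  - apply: rt_step; rewrite -!catA !(catA p); exact: CfgStep.
  - exact: rt_refl.
  - exact: rt_trans IH1 IH2.
elim=> {s w} [|a s w _ IH|N r s w1 w2 Nr _ IH1 _ IH2].
- exact: rt_refl.
- by have := ctx [:: inr a] [::] _ _ IH; rewrite !cats0.
- apply: (rt_trans _ _ _ (r ++ s)).
    by apply/rt_step/(CfgStep [::] s Nr).
  rewrite map_cat; apply: (rt_trans _ _ _ (map inr w1 ++ s)).
    by have := ctx [::] s _ _ IH1.
  by have := ctx (map inr w1) [::] _ _ IH2; rewrite !cats0.
Qed.

Lemma cfg_langP w : cfg_lang G w <-> derives [:: inl (cfg_start G)] w.
Proof. exact: derivesP. Qed.

Section Soundness.
Variable P : cfg_nonterm G -> seq A -> Prop.

(** Extends an intended meaning [P] of the nonterminals to sentential forms, so that soundness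
    becomes one check per rule. *)
Fixpoint yields (s : seq sym) (w : seq A) : Prop :=
  match s with
  | [::] => w = [::]
  | inr a :: s' => exists2 w', w = a :: w' & yields s' w'
  | inl N :: s' => exists w1 w2, [/\ w = w1 ++ w2, P N w1 & yields s' w2]
  end.

Lemma derives_yields s w :
  (forall N r v, (N, r) \in cfg_rules G -> yields r v -> P N v) ->
  derives s w -> yields s w.
Proof.
move=> rulesP; elim=> {s w} //= [a s w _ IH|N r s w1 w2 Nr _ IH1 _ IH2].
  by exists w.
by exists w1, w2; split=> //; apply: rulesP Nr IH1.
Qed.

End Soundness.

Lemma derives_single N r w : (N, r) \in cfg_rules G -> derives r w ->
  derives [:: inl N] w.
Proof.
by move=> Nr rw; rewrite -[w]cats0; apply: derives_nonterm Nr rw derives_nil.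
Qed.

End Derivations.

Arguments derives {A} G s w.

Definition cfg_of_rules (A N : finType) (start : N)
    (rules : N -> seq (seq (N + A))) : cfg A :=
  Cfg start [seq (n, r) | n <- enum N, r <- rules n].

Lemma mem_cfg_of_rules (A N : finType) (start : N)
    (rules : N -> seq (seq (N + A))) n r :
  ((n, r) \in cfg_rules (cfg_of_rules start rules)) = (r \in rules n).
Proof.
apply/allpairsPdep/idP => [[n' [r' [_ r'n' [-> ->]]]] // | nr].
by exists n, r; rewrite mem_enum.
Qed.

(** * Preimages of context-free languages under finite transducers *)

(* A move of the transducer either reads a letter of [A] or writes a letter of
   [B]. *)
Section Transduction.
Variables (A B Q : finType) (reads : Q -> A -> Q -> bool).
Variables (writes : Q -> B -> Q -> bool) (q0 : Q) (final : pred Q).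

Inductive transduces : Q -> seq A -> seq B -> Prop :=
| transduces_final q : final q -> transduces q [::] [::]
| transduces_read q a q' w d :
    reads q a q' -> transduces q' w d -> transduces q (a :: w) d
| transduces_write q b q' w d :
    writes q b q' -> transduces q' w d -> transduces q w (b :: d).

(* [run1] and [run] cut a computation after each write, so that runs can be split
   along any factorization of the output; [idle] is the final reading. *)
Inductive run1 : Q -> seq A -> B -> Q -> Prop :=
| run1_write q b q' : writes q b q' -> run1 q [::] b q'
| run1_read q a q' w b q'' :
    reads q a q' -> run1 q' w b q'' -> run1 q (a :: w) b q''.

Inductive run : Q -> seq A -> seq B -> Q -> Prop :=
| run_nil q : run q [::] [::] q
| run_cons q w b q' w' d q'' :
    run1 q w b q' -> run q' w' d q'' -> run q (w ++ w') (b :: d) q''.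

Lemma run_cat q1 w d q2 w' d' q3 :
  run q1 w d q2 -> run q2 w' d' q3 -> run q1 (w ++ w') (d ++ d') q3.
Proof.
move=> r; elim: r w' d' q3 => //= {}q1 {}w b q w2 {}d {}q2 r1 _ IH w' d' q3 r.
by rewrite -catA; apply: run_cons r1 _; apply: IH.
Qed.

Lemma run_catE q1 w d d' q3 : run q1 w (d ++ d') q3 ->
  exists w1 w2 q2, [/\ w = w1 ++ w2, run q1 w1 d q2 & run q2 w2 d' q3].
Proof.
elim: d q1 w => [|b d IHd] q1 w r /=.
  by exists [::], w, q1; split=> //; apply: run_nil.
inversion r as [|? w1 ? q2 w2 ? ? r1 r2]; subst.
have [w3 [w4 [q [-> r3 r4]]]] := IHd _ _ r2.
exists (w1 ++ w3), w4, q; split=> //; rewrite ?catA //.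
exact: run_cons r1 r3.
Qed.

Inductive idle : Q -> seq A -> Prop :=
| idle_final q : final q -> idle q [::]
| idle_read q a q' w : reads q a q' -> idle q' w -> idle q (a :: w).

(** Every read is attached to the next write; the reads after the last write form the [idle]
    part. *)
Lemma transducesP q w d : transduces q w d <->
  exists w1 w2 q', [/\ w = w1 ++ w2, run q w1 d q' & idle q' w2].
Proof.
split.
  elim=> {q w d} [q fq|q a q' w d qq' _ [w1 [w2 [q'' [-> r i]]]]|q b q' w d qq' _].
  - by exists [::], [::], q; split=> //; [apply: run_nil | apply: idle_final].
  - inversion r as [|? w3 b q2 w4 d' ? r1 r2]; subst.
      by exists [::], (a :: w2), q; split; [|apply: run_nil|apply: idle_read i].
    exists ((a :: w3) ++ w4), w2, q''; split=> //.
    by apply: run_cons r2; apply: run1_read r1.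
  - move=> [w1 [w2 [q'' [-> r i]]]]; exists ([::] ++ w1), w2, q''; split=> //.
    by apply: run_cons r; apply: run1_write.
move=> [w1 [w2 [q' [-> r i]]]]; elim: r i => {q w w1 d q'} [q|].
  by elim=> {q w2} [q fq|q a q' w qq' _]; [apply: transduces_final|apply: transduces_read].
move=> q w b q' w' d q'' r1 _ IH i; rewrite -catA.
elim: r1 (IH i) => {q b q' IH} [q b q' qq' t|q a q' v b q3 qq' _ IH t] /=.
  exact: transduces_write t.
by apply: transduces_read qq' (IH t).
Qed.

Variable G : cfg B.
Local Notation sym := (cfg_nonterm G + B)%type.
Local Notation nonterm := (option (Q * sym * Q + Q)).
Local Notation segment q c q' := (Some (inl (q, c, q'))).
Local Notation tail q := (Some (inr q)).

(** All ways of threading intermediate states through a right-hand side. *)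
Fixpoint chains (s : seq sym) (q q' : Q) : seq (seq (nonterm + A)) :=
  if s is c :: s' then
    [seq inl (segment q c q1) :: t | q1 <- enum Q, t <- chains s' q1 q']
  else if q == q' then [:: [::]] else [::].

(* The product construction: [segment q c q'] derives the inputs of the runs from
   [q] to [q'] whose output derives from [c]. *)
Definition transducer_rules (n : nonterm) : seq (seq (nonterm + A)) :=
  match n with
  | None => [seq [:: inl (segment q0 (inl (cfg_start G)) q); inl (tail q)]
            | q <- enum Q]
  | segment q (inl N) q' =>
    flatten [seq chains Nr.2 q q' | Nr <- cfg_rules G & Nr.1 == N]
  | segment q (inr b) q' =>
    (if writes q b q' then [:: [::]] else [::]) ++
    [seq [:: inr aq.1; inl (segment aq.2 (inr b) q')]
    | aq <- enum {: A * Q} & reads q aq.1 aq.2]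
  | tail q =>
    (if final q then [:: [::]] else [::]) ++
    [seq [:: inr aq.1; inl (tail aq.2)]
    | aq <- enum {: A * Q} & reads q aq.1 aq.2]
  end.

Definition transducer_cfg := cfg_of_rules None transducer_rules.

Definition transducer_sem (n : nonterm) (w : seq A) : Prop :=
  match n with
  | None => exists2 d, derives G [:: inl (cfg_start G)] d & transduces q0 w d
  | segment q c q' => exists2 d, derives G [:: c] d & run q w d q'
  | tail q => idle q w
  end.

Lemma chains_yields s q q' r w : r \in chains s q q' ->
  yields transducer_sem (G := transducer_cfg) r w ->
  exists2 d, derives G s d & run q w d q'.
Proof.
elim: s q r w => [|c s IHs] q r w /=.
  case: eqP => // <-; rewrite inE => /eqP -> /= ->.
  by exists [::]; [apply: derives_nil | apply: run_nil].
case/allpairsPdep=> q1 [t [_ /IHs {}IHs ->]] /= [w1 [w2 [-> [d1 cd1 r1]]]].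
move=> /IHs [d2 sd2 r2]; exists (d1 ++ d2); last exact: run_cat r1 r2.
exact: (derives_cat cd1 sd2).
Qed.

Lemma derives_transducer_sound n w : derives transducer_cfg [:: inl n] w ->
  transducer_sem n w.
Proof.
pose P := @yields _ transducer_cfg transducer_sem.
have inP m r v : (m, r) \in cfg_rules transducer_cfg -> P r v ->
    transducer_sem m v.
  rewrite mem_cfg_of_rules; case: m => [[[[q [N|b]] q']|q]|] /=.
  - case/flattenP=> _ /mapP [[N' s] + ->]; rewrite mem_filter => /andP [/eqP /= -> Ns].
    move=> rs /(chains_yields rs) [d sd qd]; exists d => //.
    exact: derives_single Ns sd.
  - rewrite mem_cat => /orP [].
      case: ifP => // qq'; rewrite inE => /eqP -> /= ->.
      exists [:: b]; first exact/derives_term/derives_nil.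
      exact: run_cons (run1_write qq') (run_nil _).
    case/mapP=> -[a q1]; rewrite mem_filter => /andP [/= qq1 _] -> /= [w' ->].
    move=> [w1 [_ [-> [d bd r1] ->]]]; exists d => //; move: r1; rewrite cats0.
    (* A terminal derives only itself, so the run makes a single write. *)
    inversion bd as [|? ? ? bd'|]; subst; inversion bd'; subst => r1.
    inversion r1 as [|? w3 ? q2 w4 ? ? r2 r3]; subst.
    by apply: (@run_cons _ (a :: w3)) r3; apply: run1_read r2.
  - rewrite mem_cat => /orP [].
      case: ifP => // fq; rewrite inE => /eqP -> /= ->; exact: idle_final.
    case/mapP=> -[a q1]; rewrite mem_filter => /andP [/= qq1 _] -> /= [w' ->].
    by move=> [w1 [_ [-> i ->]]]; rewrite cats0; apply: idle_read i.
  - case/mapP=> q _ -> /= [w1 [w' [-> [d Gd qd]]]] [w2 [_ [-> i ->]]].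
    by rewrite cats0; exists d => //; apply/transducesP; exists w1, w2, q.
by move/(derives_yields inP) => /= [w1 [_ [-> + ->]]]; rewrite cats0.
Qed.

(** The run is cut wherever the derivation factors its output, and the states at the cuts select the
    member of [chains]. *)
Lemma derives_segment s d q w q' : derives G s d -> run q w d q' ->
  exists2 r, r \in chains s q q' & derives transducer_cfg r w.
Proof.
move=> sd; elim: sd q w q' => {s d} [|b s d _ IH|N r s d1 d2 Nr rd1 IH1 _ IH2] q w q'.
- move=> r; inversion r; subst; exists [::]; last exact: derives_nil.
  by rewrite /= eqxx inE.
- move=> r; inversion r as [|? w1 ? q1 w2 ? ? r1 r2]; subst.
  have [t tin tw2] := IH _ _ _ r2.
  exists (inl (segment q (inr b) q1) :: t).
    by apply/allpairsPdep; exists q1, t; rewrite mem_enum.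
  rewrite -cat1s; apply: derives_cat tw2; elim: r1 => {r q w1 b q1 w2 r2 tin t IH}.
  + move=> q b q1 qq1; apply: derives_single (derives_nil _).
    by rewrite mem_cfg_of_rules /= qq1 inE.
  + move=> q a q1 w1 b q2 qq1 _ IH; apply: derives_single (derives_term _ IH).
    rewrite mem_cfg_of_rules /= mem_cat; apply/orP; right; apply/mapP.
    by exists (a, q1); rewrite // mem_filter /= qq1 mem_enum.
- move=> /run_catE [w1 [w2 [q1 [-> /IH1 [t1 t1in t1w1] /IH2 [t2 t2in t2w2]]]]].
  exists (inl (segment q (inl N) q1) :: t2).
    by apply/allpairsPdep; exists q1, t2; rewrite mem_enum.
  apply: derives_nonterm t1w1 t2w2; rewrite mem_cfg_of_rules /=.
  apply/flattenP; exists (chains r q q1) => //; apply/mapP; exists (N, r) => //.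
  by rewrite mem_filter /= eqxx.
Qed.

Lemma transducer_cfgP w : cfg_lang transducer_cfg w <->
  exists2 d, cfg_lang G d & transduces q0 w d.
Proof.
split=> [/cfg_langP /derives_transducer_sound [d Gd qd]|[d /cfg_langP Gd]].
  by exists d => //; apply/cfg_langP.
move=> /transducesP [w1 [w2 [q [-> r i]]]]; apply/cfg_langP.
apply: (@derives_single _ transducer_cfg None
          [:: inl (segment q0 (inl (cfg_start G)) q); inl (tail q)]).
  by rewrite mem_cfg_of_rules; apply/mapP; exists q; rewrite ?mem_enum.
apply: (@derives_cat _ _ [:: _] [:: _]).
  have [_ /allpairsPdep [q1 [t [_ + ->]]]] := derives_segment Gd r.
  by rewrite /=; case: eqP => // <-; rewrite inE => /eqP ->.
elim: i => {w1 w2 r q} [q fq|q a q' w2 qq' _ IH].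
  apply: derives_single (derives_nil _).
  by rewrite mem_cfg_of_rules /= fq inE.
apply: derives_single (derives_term _ IH).
rewrite mem_cfg_of_rules /= mem_cat; apply/orP; right; apply/mapP.
by exists (a, q'); rewrite // mem_filter /= qq' mem_enum.
Qed.

End Transduction.

(** * Homomorphisms on several tapes *)

Definition on_tape (T I : eqType) (tape : T -> I) (i : I) (s : seq T) :=
  [seq x <- s | tape x == i].

Lemma on_tape_cons (T I : eqType) (tape : T -> I) i x s :
  on_tape tape i (x :: s) =
  if i == tape x then x :: on_tape tape i s else on_tape tape i s.
Proof. by rewrite /on_tape /= eq_sym. Qed.

(* Letters carry the tape they are on.  The state of the transducer holds, for
   each tape, the part of the image of the last letter read that is not yet
   written; a letter is read only when the buffer of its tape is empty. *)
Section Buffers.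
Variables (A B I : finType) (tapeA : A -> I) (tapeB : B -> I) (h : A -> seq B).

(** A buffer never exceeds the longest image of a letter, which keeps the state set finite. *)
Let n := \max_(a : A) size (h a).
Let Q := {ffun I -> n.-bseq B}.

Definition buffer_reads (q : Q) a (q' : Q) : bool :=
  (q (tapeA a) == [::] :> seq B) &&
  [forall i, q' i == (if i == tapeA a then h a else q i) :> seq B].

Definition buffer_writes (q : Q) b (q' : Q) : bool :=
  [forall i, q i == (if i == tapeB b then b :: q' i else q' i) :> seq B].

Definition buffer_empty (q : Q) : bool := [forall i, q i == [::] :> seq B].

Local Notation H w := (flatten [seq h a | a <- w]).
Local Notation transduces :=
  (transduces buffer_reads buffer_writes buffer_empty).

(** The invariant on each tape: the buffer followed by the images still to be read is what remains
    to be written. *)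
Lemma buffer_transduces_sound q w d i : transduces q w d ->
  q i ++ H (on_tape tapeA i w) = on_tape tapeB i d.
Proof.
elim=> {q w d} [q /forallP /(_ i) /eqP -> //||] q x q' w d.
  move=> /andP [/eqP qx /forallP /(_ i) /eqP q'i] _ <-.
  by rewrite on_tape_cons q'i; case: eqP => [->|//]; rewrite /= qx.
move=> /forallP /(_ i) /eqP -> _; rewrite on_tape_cons => <-.
by case: eqP.
Qed.

(** The output dictates the interleaving: its next letter is written if the buffer of its tape is
    not empty, and otherwise a letter of that tape is read. Each move shortens what is left to read
    or to write. *)
Lemma buffer_transduces_complete (q : Q) u d :
  (forall i, all (fun a => tapeA a == i) (u i)) ->
  (forall i, q i ++ H (u i) = on_tape tapeB i d) ->
  exists2 w, (forall i, on_tape tapeA i w = u i) & transduces q w d.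
Proof.
have [m] := ubnP (size d + \sum_i size (u i)); elim: m q u d => // m IHm q u d.
rewrite ltnS => sz_m tape_u quE.
have read i a u' : q i = [::] :> seq B -> u i = a :: u' ->
    exists2 w, (forall i, on_tape tapeA i w = u i) & transduces q w d.
  move=> qi ui; have := tape_u i; rewrite ui /= => /andP [/eqP ai tape_u'].
  have le_n : (size (h a) <= n)%N by apply: (leq_bigmax a).
  pose q' : Q := [ffun j => if j == i then Bseq le_n else q j].
  pose v j := if j == i then u' else u j.
  have [|||w wE q'w] := IHm q' v d.
  - apply: leq_trans sz_m; rewrite (bigD1 i) //= [X in (_ <= _ + X)%N](bigD1 i) //=.
    rewrite {1}/v eqxx ui /=.
    suff: (\sum_(j | j != i) size (v j) <= \sum_(j | j != i) size (u j))%N.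
      by rewrite /v; lia.
    by apply: leq_sum => j /negPf; rewrite /v => ->.
  - by move=> j; rewrite /v; case: eqP => // ->.
  - move=> j; rewrite /v ffunE; case: eqP => [->|//] /=.
    by rewrite -quE qi ui.
  exists (a :: w).
    by move=> j; rewrite on_tape_cons wE /v ai; case: eqP => [->|].
  apply: transduces_read q'w; rewrite /buffer_reads ai qi eqxx /=.
  by apply/forallP=> j; rewrite ffunE; case: ifP.
case: d => [|b d] in sz_m quE read IHm *.
  (* With no output left the buffers are empty, and the letters still to be read have empty
     images. *)
  have q0 i : q i = [::] :> seq B by have := quE i => /=; case: (q i : seq B).
  case: (pickP (fun i => u i != [::])) => [i|u0].
    by case def_u: (u i) => [|a u'] // _; apply: read (q0 i) def_u.
  exists [::] => [i|]; first by have /eqP -> := negbFE (u0 i).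
  by apply/transduces_final/forallP=> i; rewrite q0.
have := quE (tapeB b); rewrite on_tape_cons eqxx.
case def_q: (q (tapeB b) : seq B) => [|b' s] /=.
  by case def_u: (u (tapeB b)) => [|a u'] // _; apply: read def_q def_u.
case=> def_b qu; subst b'.
have le_n : (size s <= n)%N.
  by apply: ltnW; have := size_bseq (q (tapeB b)); rewrite def_q.
pose q' : Q := [ffun j => if j == tapeB b then Bseq le_n else q j].
have [|//||w wE q'w] := IHm q' u d.
- exact: leq_trans sz_m.
- move=> j; rewrite ffunE; have := quE j; rewrite on_tape_cons.
  by case: eqP => [->|//]; rewrite def_q => -[].
exists w => //; apply: transduces_write q'w; apply/forallP=> j; rewrite ffunE.
by case: (eqVneq j (tapeB b)) => [->|]; rewrite ?def_q.
Qed.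

(** On one tape this is closure under inverse homomorphisms. On several tapes only the contents of
    the tapes are compared, since a word of [L] may change tape in the middle of the image of a
    letter. *)
Lemma context_free_multitape (L : set (seq B)) : context_free L ->
  exists2 K : set (seq A), context_free K &
    forall u, (forall i, all (fun a => tapeA a == i) (u i)) ->
      (exists2 w, K w & forall i, on_tape tapeA i w = u i) <->
      (exists2 d, L d & forall i, on_tape tapeB i d = H (u i)).
Proof.
move=> [G ->].
set G' := transducer_cfg buffer_reads buffer_writes [ffun=> [bseq]] buffer_empty G.
exists (cfg_lang G'); first by exists G'.
move=> u tape_u; split=> [[w /transducer_cfgP [d Gd qwd] wE]|[d Gd dE]].
  exists d => // i; rewrite -wE -(buffer_transduces_sound i qwd) ffunE //.
have [|w wE qwd] := @buffer_transduces_complete [ffun=> [bseq]] u d tape_u.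
  by move=> i; rewrite ffunE dE.
by exists w => //; apply/transducer_cfgP; exists d.
Qed.

End Buffers.

(** * From grammars to two-tape automata *)

(** Tape [false] is the first tape and [true] the second. *)
Definition track (A : eqType) (i : bool) (w : seq (bool * A)) : seq A :=
  [seq a.2 | a <- on_tape fst i w].

Lemma track_cons (A : eqType) i (a : bool * A) w :
  track i (a :: w) = if i == a.1 then a.2 :: track i w else track i w.
Proof. by rewrite /track on_tape_cons; case: ifP. Qed.

Lemma track_cat (A : eqType) i (v w : seq (bool * A)) :
  track i (v ++ w) = track i v ++ track i w.
Proof. by rewrite /track /on_tape filter_cat map_cat. Qed.

(* Top-down parsing: the stack holds a sentential form above the marker
   [inr true]; the initial stack is [inr false]. *)
Section TopDown.
Variables (A : finType) (G : cfg (bool * A)%type).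
Local Notation stack := ((cfg_nonterm G + bool * A) + bool)%type.

Definition topdown_trans :
    seq (bool * option A * option A * stack * bool * seq stack)%type :=
  (false, None, None, inr false, false,
     [:: inl (inl (cfg_start G)); inr true]) ::
  (false, None, None, inr true, true, [::]) ::
  [seq (false, None, None, inl (inl r.1), false, map inl r.2)
  | r <- cfg_rules G] ++
  [seq (false, if c.1 then None else Some c.2,
        if c.1 then Some c.2 else None, inl (inr c), false, [::])
  | c <- enum {: bool * A}].

Definition topdown_pda : pda2 A :=
  @Pda2 A bool stack false (inr false) [set true] topdown_trans.

Let reaches := clos_refl_trans _ (@pda2_step A topdown_pda).

Lemma topdown_derives s w u v (st : seq stack) : derives G s w ->
  reaches (false, track false w ++ u, track true w ++ v, map inl s ++ st)
        (false, u, v, st).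
Proof.
move=> d; elim: d u v st => {s w} [|[b a] s w _ IH|N r s w1 w2 Nr _ IH1 _ IH2] u v st.
- exact: rt_refl.
- apply: rt_trans (IH u v st); apply: rt_step; rewrite !track_cons.
  have in_trans : (false, if b then None else Some a, if b then Some a else None,
      inl (inr (b, a)), false, [::]) \in topdown_trans.
    rewrite !inE mem_cat; apply/orP; right; apply/orP; right; apply/orP; right.
    by apply/mapP; exists (b, a); rewrite ?mem_enum.
  have := @Pda2Step A topdown_pda _ _ _ _ _ _ (track false w ++ u)
    (track true w ++ v) (map inl s ++ st) in_trans.
  by case: b in_trans.
- rewrite !track_cat -!catA; apply: rt_trans (IH2 u v st).
  apply: rt_trans (IH1 _ _ _); apply: rt_step.
  apply: (@Pda2Step A topdown_pda _ None None _ _ (map inl r)).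
  rewrite !inE mem_cat; apply/orP; right; apply/orP; right; apply/orP; left.
  by apply/mapP; exists (N, r).
Qed.

(** An invariant propagated backwards from acceptance: in the working state, the rest of the tapes
    must be the tracks of a word derived from the stack. The second alternative treats the initial
    stack as the start symbol. *)
Definition topdown_accepts (c : pda2_config topdown_pda) : Prop :=
  let: (q, u, v, st) := c in
  if q then u = [::] /\ v = [::] else
  forall s, (st = map inl s ++ [:: inr true] \/
             st = [:: inr false] /\ s = [:: inl (cfg_start G)]) ->
  exists w, [/\ derives G s w, track false w = u & track true w = v].

Lemma topdown_accepts_step c c' :
  pda2_step c c' -> topdown_accepts c' -> topdown_accepts c.
Proof.
case=> p a b z q g u v s; rewrite /= !inE mem_cat.
case/or3P; last case/orP.
- move=> /eqP [-> -> -> -> -> ->] /= acc s' [|[[s0] ->]]; first by case: s'.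
  by apply: acc; left; rewrite s0.
- move=> /eqP [-> -> -> -> -> _] /= [-> ->] [|x s'] [|[]] //= _.
  by exists [::]; split=> //; apply: derives_nil.
- move=> /mapP [[N r] Nr [-> -> -> -> -> ->]] /= acc [|[N'|a'] s'] [|[]] //=.
  move=> [] <- def_s; have [|w [/derives_catE [w1 [w2 [-> d1 d2]]] <- <-]] := acc (r ++ s').
    by left; rewrite def_s map_cat catA.
  exists (w1 ++ w2); split=> //; exact: derives_nonterm Nr d1 d2.
- move=> /mapP [[i x] _ [-> -> -> -> -> ->]] /= acc [|[N'|a'] s'] [|[]] //=.
  move=> [] <- def_s; have [|w [dw <- <-]] := acc s'; first by left.
  by exists ((i, x) :: w); split; [apply: derives_term|case: i acc..].
Qed.

Lemma topdown_pdaP : pda2_rel topdown_pda =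
  [set uv : seq A * seq A | exists2 w, cfg_lang G w & uv = (track false w, track true w)].
Proof.
apply/seteqP; split=> [[u v]|_ [w /cfg_langP Gw ->]] /=; last first.
  exists true; first exact: set11.
  exists [::]; apply: (rt_trans _ _ _ (false, track false w, track true w,
    [:: inl (inl (cfg_start G)); inr true] : seq stack)).
    apply: rt_step; apply: (@Pda2Step A topdown_pda false None None (inr false) false
      [:: inl (inl (cfg_start G)); inr true] _ _ [::]).
    by rewrite !inE eqxx.
  have := @topdown_derives _ _ [::] [::] [:: inr true] Gw; rewrite !cats0 => st.
  apply: rt_trans st _; apply: rt_step.
  apply: (@Pda2Step A topdown_pda false None None (inr true) true
    [::] [::] [::] [::]).
  by rewrite !inE eqxx orbT.
move=> [q]; rewrite inE => /eqP -> [st /clos_rt_rt1n_iff run].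
suff: topdown_accepts (false, u, v, [:: inr false]).
  move=> /(_ [:: inl (cfg_start G)]) [|w [/cfg_langP Gw <- <-]]; first by right.
  by exists w.
have: topdown_accepts (true, [::], [::], st) by [].
by elim: run => // c1 c2 c3 step _ IH /IH; apply: topdown_accepts_step step.
Qed.

End TopDown.

Lemma context_free_rel_track (A : finType) (K : set (seq (bool * A))) :
  context_free K ->
  context_free_rel [set uv : seq A * seq A | exists2 w, K w & uv = (track false w, track true w)].
Proof. by move=> [G ->]; exists (topdown_pda G); rewrite topdown_pdaP. Qed.

(** * Grammars for pairs of paths with the same maximum and endpoint *)

Lemma map_track (A : eqType) i (w : seq (bool * A)) :
  [seq (i, a) | a <- track i w] = on_tape fst i w.
Proof.
by elim: w => // -[j a] w IHw; rewrite track_cons on_tape_cons /=; case: eqP => [<-|] //=;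
  rewrite -IHw.
Qed.

Lemma track_map (A : eqType) i j (u : seq A) :
  track i [seq (j, a) | a <- u] = if i == j then u else [::].
Proof.
elim: u => [|a u IHu]; first by case: ifP.
by rewrite /= track_cons IHu /=; case: (i == j).
Qed.

(** * Two tapes: both paths advance level by level in step *)

Section TwoTapeGrammar.
Local Notation nonterm := (bool + bool)%type.
Local Notation terminal := (bool * bool)%type.
Local Notation top := (inl (inl false) : nonterm + terminal).
Local Notation descent := (inl (inl true) : nonterm + terminal).
Local Notation excursion i := (inl (inr i) : nonterm + terminal).
Local Notation step i b := (inr (i, b) : nonterm + terminal).

(** One nonterminal for each of [same_top] and [same_descent], one per tape for [dyck], and one rule
    per constructor. *)
Definition two_tape_rules (n : nonterm) : seq (seq (nonterm + terminal)) :=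
  match n with
  | inl false => [:: [:: descent];
      [:: excursion false; step false true; excursion true; step true true; top]]
  | inl true => [:: [:: excursion false; excursion true];
      [:: excursion false; step false false; excursion true; step true false;
          descent]]
  | inr i => [:: [::];
      [:: step i false; excursion i; step i true; excursion i]]
  end.

Definition two_tape_cfg : cfg terminal := cfg_of_rules (inl false) two_tape_rules.

Definition two_tape_sem (n : nonterm) (w : seq terminal) : Prop :=
  match n with
  | inl false => same_top (track false w) (track true w)
  | inl true => same_descent (track false w) (track true w)
  | inr i => dyck (track i w) /\ track (~~ i) w = [::]
  end.

Lemma two_tape_cfg_sound w : cfg_lang two_tape_cfg w ->
  same_top (track false w) (track true w).
Proof.
move=> /cfg_langP; suff rulesP n r s : (n, r) \in cfg_rules two_tape_cfg ->
    @yields _ two_tape_cfg two_tape_sem r s -> two_tape_sem n s.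
  by move=> /(derives_yields rulesP) /= [w1 [_ [-> + ->]]]; rewrite cats0.
rewrite mem_cfg_of_rules; case: n => [[]|i]; rewrite !inE => /orP [] /eqP -> /=.
- move=> [v0 [_ [-> [d0 e0] [v1 [_ [-> [d1 e1] ->]]]]]].
  rewrite !track_cat e0 e1 /= !cats0; exact: SameDescentNil.
- move=> [v0 [_ [-> [d0 e0] [_ -> [v1 [_ [-> [d1 e1] [_ -> [v2 [_ [-> dd ->]]]]]]]]]]].
  rewrite !(track_cat, track_cons) e0 e1 /= !cats0; exact: SameDescentCons.
- move=> [v0 [_ [-> dd ->]]]; rewrite cats0; exact: SameTopDescent.
- move=> [v0 [_ [-> [d0 e0] [_ -> [v1 [_ [-> [d1 e1] [_ -> [v2 [_ [-> dd ->]]]]]]]]]]].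
  rewrite !(track_cat, track_cons) e0 e1 /= !cats0; exact: SameTopCons.
- by move=> ->; split=> //; apply: dyck_nil.
- move=> [_ -> [v0 [_ [-> [d0 e0] [_ -> [v1 [_ [-> [d1 e1] ->]]]]]]]].
  rewrite !(track_cat, track_cons) /= eqxx !cats0 e0 e1.
  by case: i d0 e0 d1 e1 => /= d0 e0 d1 e1; split=> //; apply: dyck_cons.
Qed.

Lemma derives_excursion i d : dyck d ->
  derives two_tape_cfg [:: excursion i] [seq (i, b) | b <- d].
Proof.
elim=> {d} [|d d' _ IH _ IH'].
  apply: derives_single (derives_nil _).
  by rewrite mem_cfg_of_rules inE.
apply: (@derives_single _ two_tape_cfg _ [:: step i false; excursion i; step i true; excursion i]).
  by rewrite mem_cfg_of_rules !inE eqxx orbT.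
rewrite /= map_cat; apply/derives_term/(derives_cat (s := [:: _]) IH).
exact: derives_term.
Qed.

(** Serves the climbs with [b] true and the descents with [b] false. *)
Lemma derives_pair d d' b n w : dyck d -> dyck d' ->
  derives two_tape_cfg [:: inl n] w ->
  derives two_tape_cfg [:: excursion false; step false b; excursion true;
    step true b; inl n]
    ([seq (false, c) | c <- d ++ [:: b]] ++ [seq (true, c) | c <- d' ++ [:: b]] ++ w).
Proof.
move=> dd dd' nw; rewrite !map_cat -!catA.
apply: (derives_cat (s := [:: _])); first exact: derives_excursion.
apply: derives_term; apply: (derives_cat (s := [:: _])); first exact: derives_excursion.
exact: derives_term.
Qed.

Lemma two_tape_cfgP u v : same_top u v <->
  exists2 w, cfg_lang two_tape_cfg w & u = track false w /\ v = track true w.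
Proof.
split=> [uv|[w /two_tape_cfg_sound uv [-> ->]] //].
suff [w Gw wE] : exists2 w, derives two_tape_cfg [:: top] w &
    u = track false w /\ v = track true w by exists w => //; apply/cfg_langP.
elim: uv => {u v} [u v uv|d d' u v dd dd' _ [w Gw [-> ->]]].
  suff [w Gw wE] : exists2 w, derives two_tape_cfg [:: descent] w &
      u = track false w /\ v = track true w.
    exists w => //; apply: derives_single Gw.
    by rewrite mem_cfg_of_rules inE eqxx.
  elim: uv => {u v} [d d' dd dd'|d d' u v dd dd' _ [w Gw [-> ->]]].
    exists ([seq (false, c) | c <- d] ++ [seq (true, c) | c <- d']).
      apply: (@derives_single _ two_tape_cfg _ [:: excursion false; excursion true]).
        by rewrite mem_cfg_of_rules inE eqxx.
      by apply: (@derives_cat _ _ [:: _] [:: _]); apply: derives_excursion.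
    by rewrite !track_cat !track_map cats0.
  eexists; first apply: derives_single (derives_pair false dd dd' Gw).
    by rewrite mem_cfg_of_rules !inE eqxx orbT.
  by rewrite !track_cat !track_map /= -!catA.
eexists; first apply: derives_single (derives_pair true dd dd' Gw).
  by rewrite mem_cfg_of_rules !inE eqxx orbT.
by rewrite !track_cat !track_map /= -!catA.
Qed.

End TwoTapeGrammar.

(** * One tape: the levels are nested around the separator *)

Section OneTapeGrammar.
Local Notation nonterm := (option bool).
Local Notation terminal := (option bool).
Local Notation top := (inl (Some false) : nonterm + terminal).
Local Notation descent := (inl (Some true) : nonterm + terminal).
Local Notation excursion := (inl None : nonterm + terminal).
Local Notation step b := (inr (Some b) : nonterm + terminal).
Local Notation separator := (inr None : nonterm + terminal).

(** The second path is read backwards, so a step on the left of the core is answered by the opposite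
    step on its right. *)
Definition one_tape_rules (n : nonterm) : seq (seq (nonterm + terminal)) :=
  match n with
  | Some false => [:: [:: descent];
      [:: excursion; step true; top; step false; excursion]]
  | Some true => [:: [:: excursion; separator; excursion];
      [:: excursion; step false; descent; step true; excursion]]
  | None => [:: [::]; [:: step false; excursion; step true; excursion]]
  end.

Definition one_tape_cfg : cfg terminal :=
  cfg_of_rules (Some false) one_tape_rules.

Definition one_tape_word u v : seq terminal :=
  map Some u ++ None :: map Some (reverse_path v).

Lemma one_tape_word_cons d d' b u v :
  one_tape_word (d ++ b :: u) (d' ++ b :: v) =
  map Some d ++ Some b :: one_tape_word u v ++
  Some (~~ b) :: map Some (reverse_path d').
Proof.
rewrite /one_tape_word reverse_path_cat reverse_path_cons !map_cat.
by rewrite -!catA /=.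
Qed.

Definition one_tape_sem (n : nonterm) (w : seq terminal) : Prop :=
  match n with
  | Some false => exists u v, same_top u v /\ w = one_tape_word u v
  | Some true => exists u v, same_descent u v /\ w = one_tape_word u v
  | None => exists2 d, dyck d & w = map Some d
  end.

Lemma one_tape_cfg_sound w : cfg_lang one_tape_cfg w -> one_tape_sem (Some false) w.
Proof.
move=> /cfg_langP; suff rulesP n r s : (n, r) \in cfg_rules one_tape_cfg ->
    @yields _ one_tape_cfg one_tape_sem r s -> one_tape_sem n s.
  by move=> /(derives_yields rulesP) [w1 [_ [-> + ->]]]; rewrite cats0.
rewrite mem_cfg_of_rules; case: n => [[]|]; rewrite !inE => /orP [] /eqP -> /=.
- move=> [_ [_ [-> [d dd ->] [_ -> [_ [_ [-> [d' dd' ->] ->]]]]]]].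
  (* The excursion on the right is read backwards, so the second path contains its reverse, again an
     excursion. *)
  exists d, (reverse_path d'); rewrite /one_tape_word reverse_pathK cats0.
  by split=> //; apply: SameDescentNil => //; apply: dyck_reverse.
- move=> [_ [_ [-> [d dd ->] [_ -> [_ [_ [-> [u [v [uv ->]]] [_ -> [_ [_ [-> [d' dd' ->] ->]]]]]]]]]]].
  exists (d ++ false :: u), (reverse_path d' ++ false :: v).
  rewrite one_tape_word_cons reverse_pathK cats0; split=> //.
  by apply: SameDescentCons => //; apply: dyck_reverse.
- move=> [_ [_ [-> [u [v [uv ->]]] ->]]]; exists u, v; rewrite cats0; split=> //.
  exact: SameTopDescent.
- move=> [_ [_ [-> [d dd ->] [_ -> [_ [_ [-> [u [v [uv ->]]] [_ -> [_ [_ [-> [d' dd' ->] ->]]]]]]]]]]].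
  exists (d ++ true :: u), (reverse_path d' ++ true :: v).
  rewrite one_tape_word_cons reverse_pathK cats0; split=> //.
  by apply: SameTopCons => //; apply: dyck_reverse.
- by move=> ->; exists [::] => //; apply: dyck_nil.
- move=> [_ -> [_ [_ [-> [d dd ->] [_ -> [_ [_ [-> [d' dd' ->] ->]]]]]]]].
  exists (false :: d ++ true :: d'); first exact: dyck_cons.
  by rewrite /= map_cat cats0.
Qed.

Lemma derives_dyck d : dyck d -> derives one_tape_cfg [:: excursion] (map Some d).
Proof.
elim=> {d} [|d d' _ IH _ IH'].
  apply: derives_single (derives_nil _).
  by rewrite mem_cfg_of_rules inE.
apply: (@derives_single _ one_tape_cfg _ [:: step false; excursion; step true; excursion]).
  by rewrite mem_cfg_of_rules !inE eqxx orbT.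
rewrite /= map_cat; apply/derives_term/(derives_cat (s := [:: _]) IH).
exact: derives_term.
Qed.

Lemma derives_nested d d' b n u v : dyck d -> dyck d' ->
  derives one_tape_cfg [:: inl n] (one_tape_word u v) ->
  derives one_tape_cfg [:: excursion; step b; inl n; step (~~ b); excursion]
    (one_tape_word (d ++ b :: u) (d' ++ b :: v)).
Proof.
move=> dd dd' nw; rewrite one_tape_word_cons.
apply: (derives_cat (s := [:: _])); first exact: derives_dyck.
apply: derives_term; apply: (derives_cat (s := [:: _])) nw _.
exact/derives_term/derives_dyck/dyck_reverse.
Qed.

Lemma one_tape_cfgP w : cfg_lang one_tape_cfg w <->
  exists u v, same_top u v /\ w = one_tape_word u v.
Proof.
split=> [/one_tape_cfg_sound //|[u [v [uv ->]]]]; apply/cfg_langP.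
elim: uv => {u v} [u v uv|d d' u v dd dd' _ Gw].
  apply: (@derives_single _ one_tape_cfg _ [:: descent]).
    by rewrite mem_cfg_of_rules inE eqxx.
  elim: uv => {u v} [d d' dd dd'|d d' u v dd dd' _ Gw].
    apply: (@derives_single _ one_tape_cfg _ [:: excursion; separator; excursion]).
      by rewrite mem_cfg_of_rules inE eqxx.
    apply: (derives_cat (s := [:: _])); first exact: derives_dyck.
    exact/derives_term/derives_dyck/dyck_reverse.
  apply: derives_single (derives_nested false dd dd' Gw).
  by rewrite mem_cfg_of_rules !inE eqxx orbT.
apply: derives_single (derives_nested true dd dd' Gw).
by rewrite mem_cfg_of_rules !inE eqxx orbT.
Qed.

End OneTapeGrammar.

(** * Word problems *)

Lemma k_context_free_setI (A : finType) (K L : set (seq A)) :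
  context_free K -> context_free L -> k_context_free 2 (K `&` L).
Proof.
move=> cK cL; exists (fun i : 'I_2 => if i == ord0 then K else L); split.
  by move=> i; case: ifP.
apply/seteqP; split=> [w [Kw Lw] i _|w KL]; first by case: ifP.
by split; [apply: (KL ord0)|apply: (KL ord_max)].
Qed.

Lemma k_context_free_rel_setI (A : finType) (K L : set (seq A * seq A)) :
  context_free_rel K -> context_free_rel L -> k_context_free_rel 2 (K `&` L).
Proof.
move=> cK cL; exists (fun i : 'I_2 => if i == ord0 then K else L); split.
  by move=> i; case: ifP.
apply/seteqP; split=> [w [Kw Lw] i _|w KL]; first by case: ifP.
by split; [apply: (KL ord0)|apply: (KL ord_max)].
Qed.

Definition path_of (A : Type) (f : A -> seq bool) (w : seq A) : seq bool :=
  flatten [seq f a | a <- w].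

Lemma path_of_inv_word T (f : signed T -> seq bool) w :
  (forall a, f (inv_letter a) = reverse_path (f a)) ->
  path_of f (inv_word w) = reverse_path (path_of f w).
Proof.
move=> fV; elim: w => // a w IHw.
rewrite -cat1s inv_word_cat /path_of map_cat flatten_cat.
by rewrite -[flatten _]/(path_of f _) IHw reverse_path_cat /= cats0 fV.
Qed.

Lemma path_of_negb A (f : A -> seq bool) w :
  path_of (map negb \o f) w = map negb (path_of f w).
Proof. by rewrite /path_of map_flatten -map_comp. Qed.

Lemma context_free_rel_same_top (A : finType) (f : A -> seq bool) :
  context_free_rel
    [set uv : seq A * seq A | same_top (path_of f uv.1) (path_of f uv.2)].
Proof.
have [|K cK KP] := @context_free_multitape (bool * A)%type (bool * bool)%type bool
  fst fst (fun a => [seq (a.1, b) | b <- f a.2]) (cfg_lang two_tape_cfg).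
  by exists two_tape_cfg.
suff -> : [set uv : seq A * seq A | same_top (path_of f uv.1) (path_of f uv.2)] =
    [set uv : seq A * seq A | exists2 w, K w & uv = (track false w, track true w)].
  exact: context_free_rel_track.
apply/seteqP.
(* The two words as a family indexed by the tapes, each letter tagged with its tape. *)
pose t (uv : seq A * seq A) i := [seq (i, a) | a <- if i then uv.2 else uv.1].
have t_tape uv i : all (fun a => a.1 == i) (t uv i).
  by rewrite all_map; apply/allP=> a _ /=.
have tE uv i : flatten [seq [seq (a.1, b) | b <- f a.2] | a <- t uv i] =
    [seq (i, b) | b <- path_of f (if i then uv.2 else uv.1)].
  by rewrite /path_of map_flatten -!map_comp.
split=> uv /=.
  move=> /two_tape_cfgP [d Gd [d0 d1]].
  have [_ KPt] := KP (t uv) (t_tape uv); have [|w Kw wE] := KPt.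
    exists d => // i; rewrite tE -map_track; congr map.
    by case: i; rewrite ?d0 ?d1.
  exists w => //; rewrite [LHS]surjective_pairing.
  by rewrite /track !wE -!map_comp !map_id.
move=> [w Kw def_uv].
have [KPt _] := KP (t uv) (t_tape uv); have [|d Gd dE] := KPt.
  by exists w => // i; rewrite /t def_uv /= -map_track; case: i.
apply/two_tape_cfgP; exists d => //.
by rewrite /track !dE !tE -!map_comp !map_id.
Qed.

Definition separated (A : Type) (f : A -> seq bool) (a : option A) :
    seq (option bool) :=
  if a is Some a' then map Some (f a') else [:: None].

Lemma separated_word A (f : A -> seq bool) u :
  flatten [seq separated f a | a <- map Some u] = map Some (path_of f u).
Proof. by rewrite /path_of map_flatten -!map_comp. Qed.

Lemma separated_wordE (A : finType) (f : A -> seq bool) w y :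
  flatten [seq separated f a | a <- w] = map Some y ->
  exists2 v, w = map Some v & path_of f v = y.
Proof.
elim: w y => [|[a|] w IHw] y /=; [|move=> def_y|by case: y].
  by case: y => // _; exists [::].
have [x def_x] : exists x, y = f a ++ x.
  elim: (f a) y def_y => [|b s IHs] [|c y] //=; first by exists [::].
    by exists (c :: y).
  by case=> -> /IHs [x ->]; exists x.
move: def_y; rewrite def_x map_cat => /eqP; rewrite eqseq_cat // eqxx /=.
by move=> /eqP /IHw [v -> <-]; exists (a :: v).
Qed.

(** Only the separator has an image containing [None], so its place in the image determines its
    place in [w]. *)
Lemma separatedE (A : finType) (f : A -> seq bool) w x y :
  flatten [seq separated f a | a <- w] = map Some x ++ None :: map Some y ->
  exists u v, [/\ w = map Some u ++ None :: map Some v,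
    path_of f u = x & path_of f v = y].
Proof.
elim: w x => [|[a|] w IHw] x /=; first by case: x.
  move=> def_x; have [z def_z] : exists z, x = f a ++ z.
    elim: (f a) x def_x => [|b s IHs] [|c x] //=; first by exists [::].
      by exists (c :: x).
    by case=> -> /IHs [z ->]; exists z.
  move: def_x; rewrite def_z map_cat -catA => /eqP; rewrite eqseq_cat // eqxx /=.
  by move=> /eqP /IHw [u [v [-> <- <-]]]; exists (a :: u), v.
case: x => // -[] /separated_wordE [v -> <-].
by exists [::], v.
Qed.

Lemma map_Some_separator_inj (A : Type) (u u' v v' : seq A) :
  map Some u ++ None :: map Some v = map Some u' ++ None :: map Some v' ->
  u = u' /\ v = v'.
Proof.
elim: u u' => [|a u IHu] [|a' u'] //= [].
  by move=> /(inj_map Some_inj).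
by move=> -> /IHu [-> ->].
Qed.

Lemma context_free_same_top (T : finType) (f : signed T -> seq bool) :
  (forall a, f (inv_letter a) = reverse_path (f a)) ->
  context_free [set w : seq (option (signed T)) |
    exists u v, same_top (path_of f u) (path_of f v)
                /\ w = map Some u ++ None :: map Some (inv_word v)].
Proof.
move=> fV.
(* With [unit] as the index type there is a single tape, and [K] is the inverse image under
   [separated f]. *)
have [|K cK KP] := @context_free_multitape (option (signed T)) (option bool) unit
  (fun=> tt) (fun=> tt) (separated f) (cfg_lang one_tape_cfg).
  by exists one_tape_cfg.
have tapeE (A : eqType) (s : seq A) : on_tape (fun=> tt) tt s = s.
  exact: filter_predT.
suff <- : K = [set w : seq (option (signed T)) |
    exists u v, same_top (path_of f u) (path_of f v)
                /\ w = map Some u ++ None :: map Some (inv_word v)] by [].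
have {}KP w : K w <-> cfg_lang one_tape_cfg (flatten [seq separated f a | a <- w]).
  have [|KP1 KP2] := KP (fun=> w); first by move=> i; apply/allP.
  split=> [Kw|Gw].
    have [|d Gd dE] := KP1; first by exists w => // -[].
    by rewrite -(dE tt) tapeE.
  have [|v Kv vE] := KP2; first by exists (flatten [seq separated f a | a <- w]) => // -[].
  by rewrite -(vE tt) tapeE.
apply/seteqP; split=> w /=; rewrite KP one_tape_cfgP.
  move=> [x [y [xy /separatedE [u [v [-> def_x def_y]]]]]].
  exists u, (inv_word v); rewrite inv_wordK path_of_inv_word // def_y.
  by rewrite reverse_pathK def_x.
move=> [u [v [uv ->]]]; exists (path_of f u), (path_of f v); split=> //.
rewrite map_cat flatten_cat separated_word /= separated_word.
by rewrite path_of_inv_word.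
Qed.

(** * Evaluation of words over the generators as paths *)

Section Evaluation.
Variable X : {fset FIM 'I_1}.

(** A formal inverse gets the inverted representative, not a representative of the inverse, so that
    its path is exactly the reversed path. *)
Definition letter_word (a : signed X) : seq (signed 'I_1) :=
  if a.2 then inv_word (repr (val a.1)) else repr (val a.1).

Definition letter_path (a : signed X) : seq bool := steps (letter_word a).

Lemma letter_path_inv a :
  letter_path (inv_letter a) = reverse_path (letter_path a).
Proof.
case: a => x [] /=; rewrite /letter_path /letter_word /= steps_inv_word //.
by rewrite reverse_pathK.
Qed.

Lemma eval_wordE (w : seq (signed X)) :
  eval_word w = fim_class (flatten [seq letter_word a | a <- w]).
Proof.
elim: w => [|[x b] w IHw]; first by rewrite /eval_word big_nil.
rewrite /eval_word big_cons -/(eval_word w) IHw /= fim_classM; congr (_ * _)%g.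
rewrite /eval_letter /letter_word /=; case: b; last by rewrite fim_class_repr.
by rewrite [RHS]fim_class_inv_word fim_class_repr.
Qed.

Lemma steps_letter_word (w : seq (signed X)) :
  steps (flatten [seq letter_word a | a <- w]) = path_of letter_path w.
Proof. by rewrite /path_of /steps map_flatten -map_comp. Qed.

(** The minimum of a path is, up to sign, the maximum of its mirror image, and negation preserves
    equality of endpoints. *)
Lemma eval_word_eqP (u v : seq (signed X)) : eval_word u = eval_word v <->
  same_top (path_of letter_path u) (path_of letter_path v) /\
  same_top (path_of (map negb \o letter_path) u)
           (path_of (map negb \o letter_path) v).
Proof.
rewrite !eval_wordE; split.
  move=> /fim_classP /fim_congP; rewrite !steps_letter_word => -[h h' e].
  by split; apply/same_topP; rewrite ?path_of_negb ?endpoint_negb ?e.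
rewrite !path_of_negb => -[/same_topP [h e] /same_topP [h' _]].
by apply/fim_classP/fim_congP; rewrite !steps_letter_word.
Qed.

End Evaluation.

Theorem theorem2 (X : {fset FIM 'I_1}) (hX : inverse_generates X) :
  k_context_free 2 (WP X) /\ k_context_free_rel 2 (two_tape_WP X).
Proof.
split.
  pose L (f : signed X -> seq bool) := [set w : seq (option (signed X)) |
    exists u v, same_top (path_of f u) (path_of f v)
                /\ w = map Some u ++ None :: map Some (inv_word v)].
  suff -> : WP X = L (@letter_path X) `&` L (map negb \o @letter_path X).
    apply: k_context_free_setI; apply: context_free_same_top => a /=.
      exact: letter_path_inv.
    by rewrite letter_path_inv reverse_path_negb.
  apply/seteqP; split=> [_ [u [v [/eval_word_eqP [top bottom] ->]]]|].
    by split; exists u, v.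
  move=> w [[u [v [top ->]]] [u' [v' [bottom def_w]]]]; exists u, v; split=> //.
  (* The separator occurs once and [inv_word] is injective, so both memberships concern the same
     pair of words. *)
  have [def_u /(can_inj (@inv_wordK _)) def_v] := map_Some_separator_inj def_w.
  by apply/eval_word_eqP; rewrite {2}def_u {2}def_v.
suff -> : two_tape_WP X =
    [set uv | same_top (path_of (@letter_path X) uv.1)
                       (path_of (@letter_path X) uv.2)] `&`
    [set uv | same_top (path_of (map negb \o @letter_path X) uv.1)
                       (path_of (map negb \o @letter_path X) uv.2)].
  by apply: k_context_free_rel_setI; apply: context_free_rel_same_top.
by apply/seteqP; split=> uv /eval_word_eqP.
Qed.
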